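(* Assume that $\beta > 1$ is a real number which is either: (i) a root of an equation $\beta^2 = a\beta \pm 1$ (either choice of sign), where $a$ is an integer; or (ii) the unique real root of an equation $\beta^3 = a\beta^2 + b\beta + 1$, where $a, b$ are integers and either ($a \geq 0$ and $0 \leq b \leq a+1$) or ($a \geq 2$ and $b = -1$). Then the set $\{ \lfloor \beta^i + 1/2 \rfloor \mid i \in \mathbb{N}_0 \}$ is generalised polynomial.
   Context: $\mathbb{N}_0=\{0,1,2,\dots\}$. $\lfloor x+1/2\rfloor$ is the nearest integer to $x$. The family of generalised polynomials is the smallest set of functions $f\colon \mathbb{Z} \to \mathbb{R}$ which contains all polynomial maps (with real coefficients) and is closed under addition, multiplication, and the operation $f \mapsto \lfloor f \rfloor$ of taking the (pointwise) integer part. A set $E \subset \mathbb{Z}$ is called generalised polynomial if its characteristic function $\mathbb{Z} \to \{0,1\}$ is a generalised polynomial. *)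

(* Defs.v *)
From mathcomp Require Export all_boot all_order all_algebra.
From mathcomp Require Export boolp classical_sets reals numfun.

Set Implicit Arguments.
Unset Strict Implicit.
Unset Printing Implicit Defensive.

Import Order.TTheory GRing.Theory Num.Theory.
Local Open Scope classical_set_scope.
Local Open Scope ring_scope.

(* The integer part is [Num.floor] also on negative reals. Function
   extensionality makes this a set of functions in the usual sense. *)
Inductive gen_poly (R : realType) : (int -> R) -> Prop :=
| gen_poly_poly (p : {poly R}) : gen_poly (fun n : int => p.[n%:~R])
| gen_poly_add (f g : int -> R) :
    gen_poly f -> gen_poly g -> gen_poly (fun n : int => f n + g n)
| gen_poly_mul (f g : int -> R) :
    gen_poly f -> gen_poly g -> gen_poly (fun n : int => f n * g n)
| gen_poly_floor (f : int -> R) :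
    gen_poly f -> gen_poly (fun n : int => (Num.floor (f n))%:~R).

Definition gen_poly_set (R : realType) (E : set int) : Prop :=
  gen_poly (\1_E : int -> R).

Definition nearest_int (R : realType) (x : R) : int := Num.floor (x + 2^-1).

(* Main.v *)
Require Import Defs.
From mathcomp Require Import perm ring lra zify.

Set Implicit Arguments.
Unset Strict Implicit.
Unset Printing Implicit Defensive.

Import Order.TTheory GRing.Theory Num.Theory.
Local Open Scope classical_set_scope.
Local Open Scope ring_scope.

(** Let [d] be the degree of the given equation, [C] its companion matrix,
    [t_i] the trace of [beta ^ i] (the sum of the [i]-th powers of the roots)
    and [v0 = (t_0, .., t_(d-1))], so that [C ^ i v0] is the window
    [(t_i, .., t_(i+d-1))].  The roots other than [beta] have modulus less than
    one, so for large [i] the integer nearest to [beta ^ i] is [t_i], and the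
    integer nearest to [t_i beta ^ j] is [t_(i+j)].  Hence [n = t_i] determines
    the whole vector [C ^ i v0]: it is the vector [v(n)] of the integers nearest
    to [n beta ^ j], whose entries are generalised polynomials of [n].  It
    remains to recognise, up to finitely many [n], the orbit of [v0] under [C]
    among the vectors [v(n)].

    An integer vector [v] encodes the element of the field of [beta] for which
    the traces of its products with the [beta ^ j] are the entries of [v]; the
    determinant [N(v) = det (v, C v, .., C ^ (d-1) v)] is a constant times the
    norm of that element.  The first test is [N(v(n)) = N(v0)], or
    [|N(v(n))| = |N(v0)|] together with a sign in degree two.  The second is
    that [v(n)] be congruent to some [C ^ i v0] modulo a suitable [M].  If
    [N(v0)] divides [M], the congruence forces [v(n) = P v0] with [P] an integer
    polynomial in [C], and the first test makes [P] a unit.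

    Since [beta] has only one further real conjugate, or one pair of complex
    ones, a bound on the eigenvalue [u] of [P] and on the norm bounds all
    conjugates.  So there are finitely many unit vectors with [u] between [1]
    and [beta], and by the pigeonhole principle [P ^ k = C ^ m] for some
    positive [k <= K], with [K] independent of [P] ([unit_power_bounded]).  The
    group of units may well be larger than the powers of [beta]: for example
    [beta] may be the square of another unit of the same ring.  This is where
    the congruence is used again: [M] can be chosen such that [K!] divides the
    order of [C] modulo [M] ([order_mod_multiple]).  From [P] congruent to
    [C ^ i] and [P ^ K! = C ^ m] one then gets [K! | m], so [u] is a power of
    [beta] ([orbit_filter]).

    Both tests are generalised polynomial because an integer [k] vanishes if and
    only if [sqrt 2 * k] is an integer, and whether [x] is an integer is read off
    [floor x + floor (- x)]. *)

(** * Generalised polynomials and decidable sets of integers *)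

Section GenPoly.
Context (R : realType).
Implicit Types (f g : int -> R) (b : int -> bool).

Lemma eq_gen_poly f g : f =1 g -> gen_poly f -> gen_poly g.
Proof. by move=> /funext ->. Qed.

Lemma gen_poly_cst (x : R) : gen_poly (fun=> x).
Proof.
by apply: eq_gen_poly (gen_poly_poly x%:P) => n; rewrite hornerC.
Qed.

Lemma gen_poly_id : gen_poly (fun n => n%:~R : R).
Proof. by apply: eq_gen_poly (gen_poly_poly 'X) => n; rewrite hornerX. Qed.

Lemma gen_polyN f : gen_poly f -> gen_poly (fun n => - f n).
Proof.
move=> gf; apply: eq_gen_poly (gen_poly_mul (gen_poly_cst (-1)) gf) => n.
by rewrite mulN1r.
Qed.

Lemma gen_poly_sum (I : Type) (s : seq I) (F : I -> int -> R) :
  (forall i, gen_poly (F i)) -> gen_poly (fun n => \sum_(i <- s) F i n).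
Proof.
move=> gF; elim: s => [|i s IHs].
  by apply: eq_gen_poly (gen_poly_cst 0) => n; rewrite big_nil.
by apply: eq_gen_poly (gen_poly_add (gF i) IHs) => n; rewrite big_cons.
Qed.

Lemma gen_poly_prod (I : Type) (s : seq I) (F : I -> int -> R) :
  (forall i, gen_poly (F i)) -> gen_poly (fun n => \prod_(i <- s) F i n).
Proof.
move=> gF; elim: s => [|i s IHs].
  by apply: eq_gen_poly (gen_poly_cst 1) => n; rewrite big_nil.
by apply: eq_gen_poly (gen_poly_mul (gF i) IHs) => n; rewrite big_cons.
Qed.

Lemma gen_poly_det k (A : int -> 'M[int]_k) :
  (forall i j, gen_poly (fun n => (A n i j)%:~R : R)) ->
  gen_poly (fun n => (\det (A n))%:~R : R).
Proof.
move=> gA.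
apply: (@eq_gen_poly (fun n => \sum_(s : 'S_k) (-1) ^+ s * \prod_i (A n i (s i))%:~R)).
  move=> n; rewrite rmorph_sum; apply: eq_bigr => s _.
  by rewrite rmorphM rmorph_sign rmorph_prod.
apply: gen_poly_sum => s; apply: gen_poly_mul; first exact: gen_poly_cst.
exact: gen_poly_prod.
Qed.

Lemma gen_poly_nearest f : gen_poly f ->
  gen_poly (fun n => (nearest_int (f n))%:~R : R).
Proof. by move=> gf; apply/gen_poly_floor/gen_poly_add/gen_poly_cst. Qed.

(** Boolean predicates are used instead of sets so that the closure properties
    below can be applied to conditions assembled from boolean connectives. *)
Definition gen_poly_pred b := gen_poly (fun n => (b n)%:R : R).

Lemma eq_gen_poly_pred b b' : b =1 b' -> gen_poly_pred b -> gen_poly_pred b'.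
Proof. by move=> /funext ->. Qed.

Lemma gen_poly_predC b : gen_poly_pred b -> gen_poly_pred (fun n => ~~ b n).
Proof.
move=> gb; apply: eq_gen_poly (gen_poly_add (gen_poly_cst 1) (gen_polyN gb)).
by move=> n /=; case: (b n); rewrite ?subrr ?subr0.
Qed.

Lemma gen_poly_predI b b' : gen_poly_pred b -> gen_poly_pred b' ->
  gen_poly_pred (fun n => b n && b' n).
Proof.
by move=> gb gb'; apply: eq_gen_poly (gen_poly_mul gb gb') => n; rewrite -natrM mulnb.
Qed.

Lemma gen_poly_predU b b' : gen_poly_pred b -> gen_poly_pred b' ->
  gen_poly_pred (fun n => b n || b' n).
Proof.
move=> /gen_poly_predC gb /gen_poly_predC gb'.
apply: eq_gen_poly_pred (gen_poly_predC (gen_poly_predI gb gb')) => n.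
by rewrite negb_and !negbK.
Qed.

Lemma gen_poly_pred_has (I : Type) (s : seq I) (B : I -> int -> bool) :
  (forall i, gen_poly_pred (B i)) -> gen_poly_pred (fun n => has (B^~ n) s).
Proof.
move=> gB; elim: s => [|i s IHs]; first exact: gen_poly_cst.
exact: gen_poly_predU.
Qed.

Lemma gen_poly_pred_forall (I : finType) (B : I -> int -> bool) :
  (forall i, gen_poly_pred (B i)) -> gen_poly_pred (fun n => [forall i, B i n]).
Proof.
move=> gB; have := @gen_poly_pred_has I (enum I) (fun i n => ~~ B i n).
move=> /(_ (fun i => gen_poly_predC (gB i)))/gen_poly_predC.
apply: eq_gen_poly_pred => n; apply/hasPn/forallP => [H i|H i _].
  by apply/negPn/H; rewrite mem_enum.
by rewrite negbK.
Qed.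

(** [1 + floor x + floor (- x)] is [1] at integers and [0] elsewhere. *)
Lemma gen_poly_pred_int f : gen_poly f ->
  gen_poly_pred (fun n => f n \is a Num.int).
Proof.
move=> gf; have gNf := gen_polyN gf.
apply: eq_gen_poly (gen_poly_add (gen_poly_cst 1)
  (gen_poly_add (gen_poly_floor gf) (gen_poly_floor gNf))) => n.
have := ceil_floor (f n); rewrite ceilNfloor => /eqP.
rewrite eqr_oppLR => /eqP ->; rewrite -rmorphD opprD addNKr.
by case: (f n \is a Num.int); rewrite ?oppr0 ?rmorphN ?subrr ?addr0.
Qed.

(** Irrationality of [sqrt 2]: in [2 * k ^ 2 = m ^ 2] the exponents of [2] on
    both sides have different parities. *)
Lemma sqrt2_mul_int (k : int) :
  (Num.sqrt 2 * k%:~R \is a @Num.int R) = (k == 0).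
Proof.
apply/idP/eqP => [/intrP[m mE]|->]; last by rewrite mulr0 int_num0.
apply/eqP/negPn/negP => k0.
have : (2 * `|k| ^ 2 = `|m| ^ 2)%N.
  have /(congr1 (fun x => x ^+ 2)) := mE.
  rewrite exprMn sqr_sqrtr ?ler0n// -!rmorphXn -(intrM _ 2) => /intr_inj.
  by move/(congr1 absz); rewrite abszM !abszX.
move/(congr1 (logn 2)); rewrite lognM// ?expn_gt0 ?absz_gt0 ?k0//.
by rewrite !lognX logn_prime// eqxx; lia.
Qed.

Lemma gen_poly_pred_eq (h : int -> int) (k : int) :
  gen_poly (fun n => (h n)%:~R : R) -> gen_poly_pred (fun n => h n == k).
Proof.
move=> gh; have gk := gen_poly_cst (- k%:~R).
apply: eq_gen_poly_pred (gen_poly_pred_int (gen_poly_mul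
  (gen_poly_cst (Num.sqrt 2)) (gen_poly_add gh gk))) => n /=.
by rewrite -rmorphB sqrt2_mul_int subr_eq0.
Qed.

Lemma gen_poly_pred_dvd (h : int -> int) (M : nat) : (0 < M)%N ->
  gen_poly (fun n => (h n)%:~R : R) -> gen_poly_pred (fun n => (M %| h n)%Z).
Proof.
move=> M0 gh; apply: eq_gen_poly_pred (gen_poly_pred_int (gen_poly_mul gh
  (gen_poly_cst M%:R^-1))) => n.
have M0' : M%:R != 0 :> R by rewrite pnatr_eq0 -lt0n.
apply/intrP/dvdzP => -[q hq]; exists q; last by rewrite hq intrM mulfK.
by apply: (@intr_inj R); rewrite intrM -hq divfK.
Qed.

(** Finite sets are generalised polynomial, hence a finite discrepancy between
    [E] and [b] can be repaired. *)
Lemma gen_poly_set_almost (E : set int) b (n0 : nat) : gen_poly_pred b ->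
  (forall n, (n0 <= `|n|)%N -> E n <-> b n) -> gen_poly_set R E.
Proof.
move=> gb Eb.
pose s := [seq i%:Z - n0%:Z | i <- iota 0 (n0 + n0)].
have sP (n : int) : (`|n| < n0)%N -> n \in s.
  move=> nn0; apply/mapP; exists `|(n + n0%:Z)%R|%N; first by rewrite mem_iota; lia.
  by lia.
have gmem (s' : seq int) : gen_poly_pred (fun n => n \in s').
  have := @gen_poly_pred_has int s' (fun k n => n == k).
  move=> /(_ (fun k => gen_poly_pred_eq k gen_poly_id)).
  by apply: eq_gen_poly_pred => n; rewrite -has_pred1; apply: eq_has => k; rewrite eq_sym.
apply: eq_gen_poly (gen_poly_predU (gmem [seq n <- s | n \in E])
  (gen_poly_predI (gen_poly_predC (gmem s)) gb)) => n /=.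
rewrite indicE mem_filter; congr (_%:R); congr nat_of_bool.
case: (boolP (n \in s)) => ns /=; first by rewrite andbT orbF.
rewrite andbF /=; apply/idP/idP => [/Eb En|/set_mem En]; [apply/mem_set/En|apply/Eb => //];
by rewrite leqNgt; apply: contra ns; exact: sP.
Qed.

End GenPoly.

(** * Orders of an integer matrix modulo integers *)

Definition eqmx_mod p q (M : nat) (A B : 'M[int]_(p, q)) : bool :=
  [forall i, forall j, (M %| A i j - B i j)%Z].

Lemma eqmx_modP p q M (A B : 'M[int]_(p, q)) :
  reflect (exists Y, A = B + M%:Z *: Y) (eqmx_mod M A B).
Proof.
apply: (iffP 'forall_forallP) => [dvdAB|[Y ->] i j]; last first.
  by rewrite !mxE addrAC subrr add0r dvdz_mulr.
exists (\matrix_(i, j) ((A i j - B i j) %/ M)%Z).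
apply/matrixP=> i j; rewrite !mxE mulrC divzK ?dvdAB//.
by rewrite addrC subrK.
Qed.

Lemma eqmx_mod_mul p q r M (A A' : 'M[int]_(p, q)) (B B' : 'M[int]_(q, r)) :
  eqmx_mod M A A' -> eqmx_mod M B B' -> eqmx_mod M (A *m B) (A' *m B').
Proof.
move=> /eqmx_modP[X ->] /eqmx_modP[Y ->]; apply/eqmx_modP.
exists (X *m B' + A' *m Y + M%:Z *: (X *m Y)).
rewrite mulmxDl !mulmxDr -!scalemxAl -!scalemxAr !scalerDr -!addrA; congr (_ + _).
by rewrite addrCA.
Qed.

Lemma eqmx_mod_refl p q M (A : 'M[int]_(p, q)) : eqmx_mod M A A.
Proof. by apply/eqmx_modP; exists 0; rewrite scaler0 addr0. Qed.

Lemma eqmx_mod_sym p q M (A B : 'M[int]_(p, q)) :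
  eqmx_mod M A B -> eqmx_mod M B A.
Proof.
by move=> /eqmx_modP[X ->]; apply/eqmx_modP; exists (- X); rewrite scalerN addrK.
Qed.

Lemma eqmx_mod_trans p q M (A B D : 'M[int]_(p, q)) :
  eqmx_mod M A B -> eqmx_mod M B D -> eqmx_mod M A D.
Proof.
move=> /eqmx_modP[X ->] /eqmx_modP[Y ->]; apply/eqmx_modP; exists (Y + X).
by rewrite scalerDr addrA.
Qed.

Lemma eqmx_mod_dvd p q M N (A B : 'M[int]_(p, q)) :
  (N %| M)%N -> eqmx_mod M A B -> eqmx_mod N A B.
Proof.
move=> /dvdnP[k ->] /eqmx_modP[X ->]; apply/eqmx_modP; exists (k%:Z *: X).
by rewrite scalerA -PoszM mulnC.
Qed.

Lemma eqmx_modX d M (A B : 'M[int]_d.+1) k :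
  eqmx_mod M A B -> eqmx_mod M (A ^+ k) (B ^+ k).
Proof.
move=> AB; elim: k => [|k IHk]; first by rewrite !expr0 eqmx_mod_refl.
by rewrite !exprS; exact: eqmx_mod_mul.
Qed.

Definition order_mod d (C : 'M[int]_d.+1) (M o : nat) : Prop :=
  [/\ (0 < o)%N, eqmx_mod M (C ^+ o) 1
    & forall e, eqmx_mod M (C ^+ e) 1 -> (o %| e)%N].

Lemma eqmx_modX_inj d (C : 'M[int]_d.+1) M i j : C \is a GRing.unit ->
  (i <= j)%N -> eqmx_mod M (C ^+ i) (C ^+ j) -> eqmx_mod M (C ^+ (j - i)) 1.
Proof.
move=> uC le_ij /eqmx_mod_sym e.
have := eqmx_mod_mul (eqmx_mod_refl M (C ^- i)) e.
rewrite -[X in eqmx_mod _ X]/(_ * _) -[X in eqmx_mod _ _ X]/(_ * _).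
by rewrite mulVr ?unitrX// -{1}(subnKC le_ij) exprD mulKr ?unitrX.
Qed.

(** There are finitely many residues, so two powers of the invertible matrix [C]
    agree modulo [M]. *)
Lemma order_mod_exists d (C : 'M[int]_d.+1) M :
  C \is a GRing.unit -> (0 < M)%N -> exists o, order_mod C M o.
Proof.
case: M => // M uC _.
pose f (A : 'M[int]_d.+1) : 'M['I_M.+1]_d.+1 :=
  \matrix_(i, j) inord `|(A i j %% M.+1)%Z|.
have fE A B : f A = f B -> eqmx_mod M.+1 A B.
  move=> /matrixP fAB; apply/'forall_forallP => i j.
  have /(congr1 val) := fAB i j; rewrite !mxE /=.
  have r x : (`|(x %% M.+1)%Z| < M.+1)%N.
    by rewrite -ltz_nat gez0_abs ?modz_ge0// ltz_pmod.
  rewrite !inordK// => e; rewrite -eqz_mod_dvd.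
  by apply/eqP; rewrite -[LHS]gez0_abs ?modz_ge0// e gez0_abs ?modz_ge0.
have [o o0 oC] : exists2 o, (0 < o)%N & eqmx_mod M.+1 (C ^+ o) 1.
  pose T := 'M['I_M.+1]_d.+1.
  pose g (k : 'I_#|T|.+1) := f (C ^+ k).
  have /injectivePn[i [j ij /fE gij]] : ~~ injectiveb g.
    apply/negP => /injectiveP /leq_card; rewrite card_ord.
    by rewrite ltnn.
  case: (ltngtP i j) => [lt_ij|lt_ji|/val_inj eij].
  - exists (j - i)%N; first by rewrite subn_gt0.
    by apply: eqmx_modX_inj gij => //; exact: ltnW.
  - exists (i - j)%N; first by rewrite subn_gt0.
    by apply: eqmx_modX_inj (eqmx_mod_sym gij) => //; exact: ltnW.
  - by rewrite eij eqxx in ij.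
have ex : exists o, (0 < o)%N && eqmx_mod M.+1 (C ^+ o) 1.
  by exists o; rewrite o0.
case: (ex_minnP ex) => {o o0 oC ex} o /andP[o0 oC] omin; exists o; split=> // e eC.
rewrite /dvdn; case: posnP => // r0; exfalso.
have : eqmx_mod M.+1 (C ^+ (e %% o)) 1.
  apply: eqmx_mod_trans eC; apply: eqmx_mod_sym.
  rewrite {1}(divn_eq e o) exprD mulnC exprM -[X in eqmx_mod _ _ X]mul1r.
  apply: eqmx_mod_mul (eqmx_mod_refl _ _).
  by rewrite -(expr1n _ (e %/ o)); exact: eqmx_modX.
move=> rC; have := omin _; move=> /(_ (e %% o)%N); rewrite r0 rC => /(_ isT).
by rewrite leqNgt ltn_mod o0.
Qed.

Lemma exprD1_mod2 d (X : 'M[int]_d.+1) k :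
  exists Z, (1 + X) ^+ k = 1 + X *+ k + X ^+ 2 * Z.
Proof.
elim: k => [|k [Z IHk]].
  by exists 0; rewrite mulr0 expr0 mulr0n !addr0.
exists (1 *+ k + Z + X * Z).
rewrite exprS {}IHk mulrDl mul1r !mulrDr mulr1 mulrSr expr2 !mulrA mulrnAr.
rewrite mulrnAr mulr1 -!addrA; congr (_ + (_ + _)).
rewrite [LHS]addrC -!addrA; congr (_ + (_ + _)).
by rewrite addrC.
Qed.

(** Write [C ^ o = 1 + M l ^ s Y'] with [Y'] not divisible by [l], which is
    possible because [C ^ o != 1].  Since [l] divides [M], the powers of
    [1 + M l ^ s Y'] are [1 + f M l ^ s Y'] modulo [M l ^ (s+1)], so modulo that
    number the order is exactly [l * o]. *)
Lemma order_mod_step d (C : 'M[int]_d.+1) M o l :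
  (forall e, (0 < e)%N -> C ^+ e != 1) -> (0 < M)%N -> prime l -> (l %| M)%N ->
  order_mod C M o ->
  exists2 M', (0 < M')%N && (M %| M')%N & order_mod C M' (l * o).
Proof.
move=> Cinf M0 pl lM [o0 oC omin].
have /eqmx_modP[Y CoE] := oC.
have [i [j Yij]] : exists i j, Y i j != 0.
  have : Y != 0.
    by apply: contraNneq (Cinf o o0) => Y0; rewrite CoE Y0 scaler0 addr0.
  apply: contraNP => nY; apply/eqP/matrixP => i j; rewrite mxE; apply/eqP.
  by apply: contra_notT nY => nz; exists i, j.
pose Q s := eqmx_mod (l ^ s) Y 0.
have Q0 : exists s, Q s.
  by exists 0%N; apply/eqmx_modP; exists Y; rewrite add0r scale1r.
have Qb s : Q s -> (s <= `|Y i j|)%N.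
  move=> /'forall_forallP/(_ i j); rewrite mxE subr0 dvdzE /= => /dvdn_leq.
  rewrite absz_gt0 => /(_ Yij); apply: leq_trans.
  by rewrite ltnW// ltn_expl// prime_gt1.
case: (ex_maxnP Q0 Qb) => s /eqmx_modP[Y']; rewrite add0r => YE smax {Q0 Qb}.
have l0 : (0 < l)%N := prime_gt0 pl.
pose M1 := (M * l ^ s)%N.
have M1E : C ^+ o = 1 + M1%:Z *: Y' by rewrite CoE YE scalerA -PoszM.
have lM1 : (l %| M1)%N by rewrite dvdn_mulr.
have key f : eqmx_mod (M1 * l) (C ^+ (o * f)) 1 <-> (l %| f)%N.
  have [Z EZ] := exprD1_mod2 (M1%:Z *: Y') f.
  rewrite exprM M1E {}EZ -addrA.
  have M1M1 : eqmx_mod (M1 * l) (1 + ((M1%:Z *: Y') *+ f + (M1%:Z *: Y') ^+ 2 * Z))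
      (1 + (M1%:Z *: Y') *+ f).
    apply/eqmx_modP; case/dvdnP: lM1 => h hE; exists (h%:Z *: (Y' ^+ 2 * Z)).
    rewrite exprZn addrA; congr (_ + _); rewrite scalerA -scalerAl; congr (_ *: _).
    by rewrite expr2 {2}hE -!PoszM; congr Posz; lia.
  split.
    move=> /(eqmx_mod_trans (eqmx_mod_sym M1M1)) /eqmx_modP[X].
    move=> /addrI; rewrite -scaler_nat scalerA natz PoszM mulrC -!scalerA => H.
    have M1n0 : M1%:Z != 0 by rewrite -lt0n muln_gt0 M0 expn_gt0 l0.
    have {H} fY : f%:Z *: Y' = l%:Z *: X.
      apply/matrixP=> x y; move/matrixP: H => /(_ x y); rewrite !mxE.
      by move=> /(mulfI M1n0).
    apply/negPn/negP => nlf.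
    have : Q s.+1.
      apply/'forall_forallP => x y; rewrite YE !mxE subr0 expnSr PoszM.
      apply: dvdz_mul (dvdzz _) _.
      have : (l %| f%:Z * Y' x y)%Z.
        by move/matrixP: fY => /(_ x y); rewrite !mxE => ->; rewrite dvdz_mulr.
      by rewrite Gauss_dvdzr// coprimezE /= prime_coprime.
    by move=> /smax; rewrite ltnn.
  move=> /dvdnP[h hE]; apply: (eqmx_mod_trans M1M1); rewrite {}hE.
  apply/eqmx_modP; exists (h%:Z *: Y').
  by rewrite -scaler_nat !scalerA natz -!PoszM [(_ * M1)%N]mulnC [(h * l)%N]mulnC mulnA.
exists (M1 * l)%N.
  by rewrite !muln_gt0 M0 expn_gt0 l0 /= /M1 -mulnA dvdn_mulr.
split; first by rewrite muln_gt0 l0.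
  by rewrite [(l * o)%N]mulnC key.
move=> e eC; have /dvdnP[f fE] : (o %| e)%N.
  apply: omin; apply: eqmx_mod_dvd eC.
  by rewrite /M1 -mulnA dvdn_mulr.
by move: eC; rewrite fE [(f * o)%N]mulnC key => lf; rewrite mulnC dvdn_pmul2l.
Qed.

(** The primes of [k] are introduced into the order one at a time by
    [order_mod_step], starting from the order modulo [k]; keeping [k %| M] makes
    the divisibility required by that lemma available at each step. *)
Lemma order_mod_multiple d (C : 'M[int]_d.+1) k :
  C \is a GRing.unit -> (forall e, (0 < e)%N -> C ^+ e != 1) -> (0 < k)%N ->
  exists2 M, (0 < M)%N & forall e, eqmx_mod M (C ^+ e) 1 -> (k %| e)%N.
Proof.
move=> uC Cinf k0.
suff H n : (n %| k)%N ->
    exists M o, [/\ (0 < M)%N, (k %| M)%N, order_mod C M o & (n %| o)%N].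
  have [M [o [M0 _ [_ _ omin] no]]] := H k (dvdnn k).
  by exists M => // e /omin; apply: dvdn_trans.
elim/ltn_ind: n => n IHn nk.
have n0 : (0 < n)%N := dvdn_gt0 k0 nk.
have [n1|n1] := leqP n 1.
  have [o oC] := order_mod_exists uC k0; exists k, o; split=> //.
  by have -> : n = 1%N by lia.
have pl := pdiv_prime n1; have /dvdnP[n' nE] := pdiv_dvd n.
have [||M [o [M0 kM Mo no]]] := IHn n'.
- rewrite [X in (_ < X)%N]nE ltn_Pmulr ?prime_gt1//.
  by move: n0; rewrite [X in (_ < X)%N -> _]nE muln_gt0 => /andP[].
- by apply: dvdn_trans nk; rewrite [X in (_ %| X)%N]nE dvdn_mulr.
have [|M' /andP[M'0 MM'] Mo'] := order_mod_step Cinf M0 pl _ Mo.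
  by apply: dvdn_trans kM; apply: dvdn_trans nk; exact: pdiv_dvd.
exists M', (pdiv n * o)%N; split=> //; first exact: dvdn_trans MM'.
by rewrite [X in (X %| _)%N]nE mulnC dvdn_mul.
Qed.

(** * Powers of real numbers *)

Section Powers.
Context (R : realType).
Implicit Types (x A e : R).

Lemma exists_lt_expr x A : 1 < x -> exists i, A < x ^+ i.
Proof.
move=> x1; pose i := (Num.truncn (A / (x - 1))).+1; exists i.
have bern : 1 + (x - 1) *+ i <= x ^+ i.
  elim: i => [|i IHi]; first by rewrite mulr0n addr0 expr0.
  rewrite exprS mulrS; have : 0 <= (x - 1) *+ i by rewrite mulrn_wge0// subr_ge0 ltW.
  by move: IHi; set y := _ *+ i; set z := x ^+ i; nra.
apply: lt_le_trans bern; rewrite -mulr_natr.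
have := truncnS_gt (A / (x - 1)); rewrite ltr_pdivrMr ?subr_gt0// -/i mulrC.
by move/lt_trans; apply; rewrite ltrDr.
Qed.

Lemma exists_expr_window x y : 1 < x -> 1 <= y ->
  exists i, x ^+ i <= y < x ^+ i.+1.
Proof.
move=> x1 y1; case: (ex_minnP (exists_lt_expr y x1)) => -[|i] yi imin.
  by move: yi; rewrite expr0 ltNge y1.
by exists i; rewrite yi andbT leNgt; apply/negP => /imin; rewrite ltnn.
Qed.

Lemma expr_eventually_small x A e : 0 < x < 1 -> 0 < e ->
  exists i0, forall i, (i0 <= i)%N -> A * x ^+ i < e.
Proof.
move=> /andP[x0 x1] e0.
have [i0 Hi0] : exists i, `|A| / e < x^-1 ^+ i.
  by apply: exists_lt_expr; rewrite invf_gt1.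
exists i0 => i le_i; apply: le_lt_trans (_ : `|A| * x ^+ i0 < e).
  apply: le_trans (_ : `|A| * x ^+ i <= _).
    by rewrite ler_wpM2r ?exprn_ge0 ?ler_norm// ltW.
  by rewrite ler_wpM2l// ler_wiXn2l// ltW.
have xi0 : 0 < x ^+ i0 by rewrite exprn_gt0.
move: Hi0; rewrite exprVn ltr_pdivrMr// -(ltr_pM2r xi0) mulrAC mulVf ?mul1r//.
by rewrite gt_eqF.
Qed.

End Powers.

(** * The norm form of a cyclic vector *)

Definition krylov d (C : 'M[int]_d.+1) (v : 'cV[int]_d.+1) : 'M[int]_d.+1 :=
  \matrix_(i, j) (C ^+ j *m v) i 0.

(** A multiple of the norm from the field generated by an eigenvalue of [C],
    written in coordinates for which it has integer coefficients. *)
Definition krylov_form d (C : 'M[int]_d.+1) (v : 'cV[int]_d.+1) : int :=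
  \det (krylov C v).

Section Krylov.
Context (d : nat) (C : 'M[int]_d.+1).
Implicit Types (P : 'M[int]_d.+1) (v : 'cV[int]_d.+1).

Lemma krylovE v i j : krylov C v i j = (C ^+ j *m v) i 0.
Proof. exact: mxE. Qed.

Lemma krylovM P v : GRing.comm P C -> krylov C (P *m v) = P * krylov C v.
Proof.
move=> PC; apply/matrixP => i j; rewrite [LHS]mxE mulmxA mulmxE -(commrX j PC).
rewrite -mulmxE -mulmxA [LHS]mxE [RHS]mxE.
by apply: eq_bigr => k _; rewrite [krylov _ _ _ _]mxE.
Qed.

Lemma krylov_formM P v : GRing.comm P C ->
  krylov_form C (P *m v) = \det P * krylov_form C v.
Proof. by move=> PC; rewrite /krylov_form krylovM// det_mulmx. Qed.

Lemma krylov_form_pow v i :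
  krylov_form C (C ^+ i *m v) = \det C ^+ i * krylov_form C v.
Proof.
have -> : \det C ^+ i = \det (C ^+ i).
  elim: i => [|i IHi]; first by rewrite !expr0 det1.
  by rewrite !exprS det_mulmx IHi.
by apply: krylov_formM; exact/commr_sym/commrX.
Qed.

Lemma krylov_mul v (y : 'cV[int]_d.+1) :
  krylov C v *m y = (\sum_j y j 0 *: C ^+ j) *m v.
Proof.
rewrite mulmx_suml; apply/matrixP => i k; rewrite !ord1 !mxE summxE.
by apply: eq_bigr => j _; rewrite -scalemxAl !mxE mulrC.
Qed.

(** A nonzero [krylov_form C v] means that the vectors [C ^ j v] span, so a matrix
    commuting with [C] is determined by its value at [v]. *)
Lemma krylov_cyclic P Q v : krylov_form C v != 0 ->
  GRing.comm P C -> GRing.comm Q C -> P *m v = Q *m v -> P = Q.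
Proof.
move=> D0 PC QC PQ.
have /(congr1 (fun A => A *m \adj (krylov C v))) : P *m krylov C v = Q *m krylov C v.
  by rewrite !mulmxE -!krylovM// PQ.
rewrite -!mulmxA mul_mx_adj !mul_mx_scalar => /matrixP e.
apply/matrixP => i j; have := e i j; rewrite !mxE.
by move/(mulfI D0).
Qed.

End Krylov.

(** * Nearest integers *)

Lemma nearest_intE (R : realType) (x : R) (m : int) :
  `|m%:~R - x| < 2^-1 -> nearest_int x = m.
Proof.
rewrite ltr_norml => /andP[h1 h2]; apply: floor_def; rewrite intrD.
by apply/andP; split; lra.
Qed.

Lemma nearest_int_dist (R : realType) (x : R) :
  `|(nearest_int x)%:~R - x| <= 2^-1.
Proof.
have := floor_itv (x + 2^-1); rewrite -/(nearest_int x) intrD => /andP[h1 h2].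
by rewrite ler_norml; apply/andP; split; lra.
Qed.

(** The window of the orbit of [v0] that starts at [n], if there is one and [n]
    is large. *)
Definition nearest_pows (R : realType) d (beta : R) (n : int) : 'cV[int]_d.+1 :=
  \col_j nearest_int (n%:~R * beta ^+ j).

Lemma gen_poly_krylov_form (R : realType) d (C : 'M[int]_d.+1) (beta : R) :
  gen_poly (fun n => (krylov_form C (nearest_pows d beta n))%:~R : R).
Proof.
apply: gen_poly_det => i j.
apply: (@eq_gen_poly _ (fun n => \sum_k ((C ^+ j) i k)%:~R *
    (nearest_int (n%:~R * beta ^+ k))%:~R)).
  move=> n; rewrite krylovE mxE rmorph_sum; apply: eq_bigr => k _.
  by rewrite rmorphM [nearest_pows _ _ _ _ _]mxE.
apply: gen_poly_sum => k; apply: gen_poly_mul; first exact: gen_poly_cst.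
by apply/gen_poly_nearest/gen_poly_mul; [exact: gen_poly_id | exact: gen_poly_cst].
Qed.

(** * Recognising an orbit of a Pisot matrix *)

Definition eigenform (R : realType) d (ell : 'I_d.+1 -> R)
    (v : 'cV[int]_d.+1) : R :=
  \sum_j ell j * (v j 0)%:~R.

Section PisotLattice.
Context (R : realType) (d : nat) (C : 'M[int]_d.+1) (v0 : 'cV[int]_d.+1).
Context (G : int -> bool) (beta r c : R).
Context (ell : 'I_d.+1 -> R) (rho : 'cV[int]_d.+1 -> R).
Implicit Types (P : 'M[int]_d.+1) (v w : 'cV[int]_d.+1).

Local Notation lam := (eigenform ell).
Local Notation D := (krylov_form C v0).

(** The setting shared by the two degrees.  The form [lam] is the left
    eigenvector of [C] for [beta]; it measures the component of a vector along
    the expanding direction.  The form [rho] is a quadratic form in the other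
    eigencomponents, all contracted by [C].  By [rho_bound] the head of a vector
    is governed by these two quantities, and by [rho_reduced] the norm form
    keeps [rho] bounded once [lam] is bounded below: this last property is the
    one that fails when [beta] has too many conjugates. *)
Hypothesis beta_gt1 : 1 < beta.
Hypothesis C_unit : C \is a GRing.unit.
Hypothesis C_shift : forall v (j k : 'I_d.+1),
  k = j.+1 :> nat -> (C *m v) j 0 = v k 0.
Hypothesis lamC : forall v, lam (C *m v) = beta * lam v.
Hypothesis lam0_gt0 : 0 < lam v0.
Hypothesis r01 : 0 < r < 1.
Hypothesis c_ge0 : 0 <= c.
Hypothesis rhoC : forall v, rho (C *m v) = r * rho v.
Hypothesis rho_bound : forall v,
  (lam v0 * (v 0 0)%:~R - lam v) ^+ 2 <= c * rho v.
Hypothesis D_neq0 : D != 0.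
Hypothesis rho_reduced : exists B, forall v,
  `|krylov_form C v| = `|D| -> lam v0 <= lam v -> rho v <= B.

Let beta_gt0 : 0 < beta. Proof. exact: lt_trans beta_gt1. Qed.

Lemma eigenformD v w : lam (v + w) = lam v + lam w.
Proof.
by rewrite -big_split; apply: eq_bigr => j _; rewrite mxE rmorphD mulrDr.
Qed.

Lemma eigenform0 : lam 0 = 0.
Proof. by apply: big1 => j _; rewrite mxE mulr0. Qed.

Lemma eigenformZ k v : lam (k *: v) = k%:~R * lam v.
Proof.
by rewrite mulr_sumr; apply: eq_bigr => j _; rewrite mxE rmorphM mulrCA.
Qed.

Lemma eigenform_pow i v : lam (C ^+ i *m v) = beta ^+ i * lam v.
Proof.
elim: i v => [|i IHi] v; first by rewrite mul1mx mul1r.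
by rewrite !exprS -mulmxE -mulmxA lamC IHi mulrA.
Qed.

Lemma rho_pow i v : rho (C ^+ i *m v) = r ^+ i * rho v.
Proof.
elim: i v => [|i IHi] v; first by rewrite mul1mx mul1r.
by rewrite !exprS -mulmxE -mulmxA rhoC IHi mulrA.
Qed.

Lemma eigenform_pow_inv i v : lam (C ^- i *m v) = lam v / beta ^+ i.
Proof.
have [w ->] : exists w, v = C ^+ i *m w.
  by exists (C ^- i *m v); rewrite mulmxA mulmxE mulrV ?unitrX// mul1mx.
rewrite mulmxA mulmxE mulVr ?unitrX// mul1mx eigenform_pow mulrC mulKf//.
by rewrite expf_neq0// gt_eqF.
Qed.

Lemma C_shift_pow v (j : 'I_d.+1) : v j 0 = (C ^+ j *m v) 0 0.
Proof.
have [n jn] : exists n, val j = n by exists (val j).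
elim: n j v jn => [|n IHn] j v jn.
  by rewrite jn mul1mx; congr (v _ _); apply: val_inj.
have nd : (n < d.+1)%N by rewrite -jn (ltnW (ltn_ord j)).
rewrite -(@C_shift v (Ordinal nd) j jn) (IHn (Ordinal nd) _ erefl) mulmxA mulmxE -exprSr.
by rewrite -jn.
Qed.

Lemma C_pow_neq1 e : (0 < e)%N -> C ^+ e != 1.
Proof.
move=> e0; apply/eqP => Ce1; have := eigenform_pow e v0.
rewrite Ce1 mul1mx => /esym/eqP; rewrite -[X in _ == X]mul1r.
rewrite (inj_eq (mulIf _)) ?gt_eqF//.
by rewrite exprn_egt1// -lt0n.
Qed.

(** If the expanding component of an integer vector vanishes then its iterates
    tend to zero, and integer vectors close to zero are zero. *)
Lemma eigenform_inj v : lam v = 0 -> v = 0.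
Proof.
move=> lv0.
have [i0 Hi0] := @expr_eventually_small R r (c * rho v) (lam v0 ^+ 2) r01
  (exprn_gt0 2 lam0_gt0).
have z0 i : (i0 <= i)%N -> (C ^+ i *m v) 0 0 = 0.
  move=> /Hi0 small; have := rho_bound (C ^+ i *m v).
  rewrite eigenform_pow lv0 mulr0 subr0 rho_pow mulrCA mulrA [_ * c]mulrC.
  rewrite -mulrA [_ * rho v]mulrC mulrA => /le_lt_trans/(_ small).
  rewrite exprMn -[X in _ < X]mulr1 ltr_pM2l ?exprn_gt0// => lt1.
  apply/eqP/negPn/negP => nz; move: lt1; rewrite ltNge sqr_intr_ge1 ?intr_int//.
  by rewrite intr_eq0.
have : C ^+ i0 *m v = 0.
  apply/matrixP => j k; rewrite ord1 C_shift_pow mulmxA mulmxE -exprD [RHS]mxE.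
  by rewrite z0// leq_addl.
move/(congr1 (mulmx (C ^- i0))); rewrite mulmx0 mulmxA mulmxE mulVr ?unitrX//.
by rewrite mul1mx.
Qed.

(** Cramer's rule: [|D| w] is an integer combination of the [C ^ j v0] for every
    integer vector [w]. *)
Lemma unit_of_congruence M i v :
  eqmx_mod (M * `|D|) v (C ^+ i *m v0) ->
  exists P u, [/\ GRing.comm P C, eqmx_mod M P (C ^+ i), v = P *m v0
    & forall w, lam (P *m w) = u * lam w].
Proof.
move=> /eqmx_modP[w vE].
pose y := sgz D *: (\adj (krylov C v0) *m w).
pose Q := \sum_j y j 0 *: C ^+ j.
have QC : GRing.comm Q C.
  apply/commr_sym/commr_sum => j _; rewrite /GRing.comm -scalerAr -scalerAl.
  by rewrite -exprS exprSr.
have Qv0 : Q *m v0 = `|D|%:Z *: w.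
  rewrite -krylov_mul -scalemxAr mulmxA mul_mx_adj mul_scalar_mx scalerA.
  by rewrite -/D -abszEsg.
exists (C ^+ i + M%:Z *: Q), (beta ^+ i + M%:~R * \sum_j (y j 0)%:~R * beta ^+ j).
split.
- apply/commr_sym/commrD; first exact: commrX.
  by rewrite /GRing.comm -scalerAr -scalerAl QC.
- by apply/eqmx_modP; exists Q.
- by rewrite mulmxDl -scalemxAl Qv0 scalerA -PoszM.
move=> x; rewrite mulmxDl eigenformD eigenform_pow mulrDl; congr (_ + _).
rewrite -scalemxAl eigenformZ -mulrA; congr (_ * _).
rewrite mulmx_suml mulr_suml (big_morph lam eigenformD eigenform0).
by apply: eq_bigr => j _; rewrite -scalemxAl eigenformZ eigenform_pow mulrA.
Qed.

(** Vectors in a fundamental domain for the action of the powers of [C]: each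
    entry of [v] is the head of some [C ^ j v], so [rho_bound] confines [v] to a
    box. *)
Lemma reduced_finite : exists S : seq 'cV[int]_d.+1, forall v,
  `|krylov_form C v| = `|D| -> lam v0 <= lam v < beta * lam v0 -> v \in S.
Proof.
have [B HB] := rho_reduced.
pose B1 := Num.max B 0.
pose L := (beta ^+ d.+1 * lam v0 + 1 + c * B1) / lam v0.
pose b := (Num.truncn L).+1.
exists [seq \col_i ((nat_of_ord (f i))%:Z - b%:Z) | f : {ffun 'I_d.+1 -> 'I_(b + b).+1}].
move=> v Nv /andP[v_ge v_lt].
have rv : rho v <= B1 by rewrite le_max HB.
have vb j : `|(v j 0)%:~R| <= L :> R.
  rewrite C_shift_pow; set w := C ^+ j *m v.
  have := rho_bound w; rewrite eigenform_pow rho_pow.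
  set x := lam v0 * _; set y := beta ^+ j * lam v.
  have lv0 : 0 <= lam v := le_trans (ltW lam0_gt0) v_ge.
  have y0 : 0 <= y by rewrite mulr_ge0 ?exprn_ge0// ltW.
  have yb : y <= beta ^+ d.+1 * lam v0.
    have -> : beta ^+ d.+1 * lam v0 = beta ^+ d * (beta * lam v0) by rewrite mulrA -exprSr.
    apply: ler_pM => //; first by rewrite exprn_ge0// ltW.
    - by rewrite ler_eXn2l// -ltnS.
    - exact: ltW.
  have rb : c * (r ^+ j * rho v) <= c * B1.
    apply: ler_wpM2l => //; apply: le_trans (_ : r ^+ j * B1 <= _).
      by rewrite ler_wpM2l// exprn_ge0//; case/andP: r01 => /ltW.
    rewrite ler_piMl// ?le_max ?lexx ?orbT//.
    by case/andP: r01 => r0 r1; rewrite exprn_ile1 ?ltW.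
  move=> /le_trans/(_ rb) xy.
  have xb : `|x| <= beta ^+ d.+1 * lam v0 + 1 + c * B1.
    have := sqr_ge0 (x - y - 1); have := sqr_ge0 (x - y + 1).
    have := sqr_ge0 (x - y); rewrite ler_norml; move: xy y0 yb.
    by move: (c * B1) (beta ^+ d.+1 * _) => ? ?; nra.
  rewrite -(ler_pM2l lam0_gt0) /L [X in _ <= X]mulrC divfK ?gt_eqF//.
  by rewrite -{1}(gtr0_norm lam0_gt0) -normrM.
have vbz j : `|v j 0| <= b%:Z.
  rewrite -(ler_int R) intr_norm; apply: le_trans (vb j) _.
  exact/ltW/truncnS_gt.
apply/mapP; exists [ffun i => inord `|v i 0 + b%:Z|]; first by rewrite mem_enum.
apply/matrixP => j k; rewrite !mxE ffunE ord1.
by have := vbz j; move: (v j 0) => z zb; rewrite inordK; lia.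
Qed.

(** Translate the vectors [P ^ j v0] into the fundamental domain by powers of
    [C]; as it has finitely many elements, two of the translates coincide. *)
Lemma unit_power_bounded : exists K, forall P u,
  GRing.comm P C -> (forall w, lam (P *m w) = u * lam w) -> 1 <= u ->
  `|\det P| = 1 -> exists k m, (0 < k <= K)%N /\ P ^+ k = C ^+ m.
Proof.
have [S HS] := reduced_finite; exists (size S) => P u PC lamP u1 detP.
have P_unit : P \is a GRing.unit.
  by rewrite unitmxE; move: detP; case: (\det P) => [[|[|n]]|[|n]].
have lamPX j w : lam (P ^+ j *m w) = u ^+ j * lam w.
  elim: j w => [|j IHj] w; first by rewrite mul1mx mul1r.
  by rewrite !exprS -mulmxE -mulmxA lamP IHj mulrA.
have /choice[f Hf] j : exists i, beta ^+ i <= u ^+ j < beta ^+ i.+1.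
  by apply: exists_expr_window => //; exact: exprn_ege1.
pose w j := (C ^- f j * P ^+ j) *m v0.
have wS j : w j \in S.
  apply: HS.
    rewrite krylov_formM; last first.
      by apply/commr_sym/commrM; [exact/commrV/commrX | exact/commrX/commr_sym].
    rewrite normrM -[RHS]mul1r; congr (_ * _); rewrite det_mulmx normrM.
    have -> : `|\det (P ^+ j)| = 1.
      by elim: (j) => [|n IHn]; rewrite ?expr0 ?det1// exprS det_mulmx normrM detP IHn.
    have : \det (C ^- f j) \is a GRing.unit by rewrite -unitmxE unitrV unitrX.
    by case: (\det _) => [[|[|n]]|[|n]].
  rewrite /w -mulmxE -mulmxA eigenform_pow_inv lamPX mulrAC.
  have bf : 0 < beta ^+ f j by rewrite exprn_gt0.
  have /andP[le_f lt_f] := Hf j.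
  rewrite ltr_pM2r// ltr_pdivrMr// -exprS lt_f andbT.
  by rewrite ler_peMl ?(ltW lam0_gt0)// ler_pdivlMr// mul1r.
have : ~~ uniq [seq w j | j <- iota 0 (size S).+1].
  apply/negP => uw; suff : (size [seq w j | j <- iota 0 (size S).+1] <= size S)%N.
    by rewrite size_map size_iota ltnn.
  by apply: uniq_leq_size => // x /mapP[j _ ->].
rewrite -/(mkseq w _) => /(uniqPn v0)[j [k []]]; rewrite size_mkseq => jk kS.
rewrite !nth_mkseq// ?(ltn_trans jk)// => e.
have fjk : (f j <= f k)%N.
  rewrite leqNgt; apply/negP => lt_f.
  have /andP[le1 _] := Hf j; have /andP[_ lt2] := Hf k.
  have : u ^+ j <= u ^+ k by rewrite ler_weXn2l// ltnW.
  apply/negP; rewrite -ltNge; apply: lt_le_trans lt2 _; apply: le_trans le1.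
  by rewrite ler_weXn2l// ltW.
exists (k - j)%N, (f k - f j)%N; split.
  by rewrite subn_gt0 jk (leq_trans (leq_subr _ _))// -ltnS.
have CC := commr_refl C.
have PCf n : GRing.comm (P ^+ n) C by apply/commr_sym/commrX/commr_sym.
have CCf n : GRing.comm (C ^+ n) C by apply/commr_sym/commrX.
apply: (krylov_cyclic D_neq0) => //.
have {}e : P ^+ j * C ^+ f k *m v0 = P ^+ k * C ^+ f j *m v0.
  have comP n n' : P ^+ n * C ^+ n' = C ^+ n' * P ^+ n by exact: commrX.
  rewrite !comP.
  have cancelC n n' X : C ^+ (n + n') * (C ^- n * X) = C ^+ n' * X.
    by rewrite addnC exprD -mulrA mulVKr ?unitrX.
  move/(congr1 (mulmx (C ^+ (f j + f k)))): e; rewrite /w !mulmxA !mulmxE.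
  by rewrite -![C ^+ _ * _ * _]mulrA cancelC [(f j + f k)%N]addnC cancelC.
have kE : P ^+ k = P ^+ j * P ^+ (k - j) by rewrite -exprD subnKC// ltnW.
have fE : C ^+ f k = C ^+ f j * C ^+ (f k - f j) by rewrite -exprD subnKC.
rewrite kE fE in e.
have {}e : (P ^+ j * C ^+ f j) *m (C ^+ (f k - f j) *m v0) =
           (P ^+ j * C ^+ f j) *m (P ^+ (k - j) *m v0).
  rewrite !mulmxA !mulmxE -!mulrA e; congr (_ *m _); rewrite -!mulrA.
  by congr (_ * _); exact: commrX.
have X_unit : P ^+ j * C ^+ f j \is a GRing.unit by rewrite unitrMr unitrX.
move: (P ^+ j * C ^+ f j) X_unit e => X X_unit /(congr1 (mulmx X^-1)).
by rewrite !mulmxA !mulmxE mulVr// !mul1r => ->.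
Qed.

(** The unit [P] with [v = P v0] satisfies [P ^ K! = C ^ (m * h)] and is
    congruent to [C ^ i] modulo [M].  Comparing the two and using that [K!]
    divides the order of [C] modulo [M] shows that [K!] divides [m * h].  Hence
    the eigenvalue of [P] is a power of [beta], as it is positive. *)
Lemma orbit_filter : exists2 M, (0 < M)%N & forall v i,
  `|krylov_form C v| = `|D| -> lam v0 <= lam v ->
  eqmx_mod M v (C ^+ i *m v0) -> exists j, v = C ^+ j *m v0.
Proof.
have [K HK] := unit_power_bounded.
have [M M0 HM] := order_mod_multiple C_unit C_pow_neq1 (fact_gt0 K).
exists (M * `|D|)%N; first by rewrite muln_gt0 M0 absz_gt0.
move=> v i Nv lv /unit_of_congruence[P [u [PC PM vE lamP]]].
have u1 : 1 <= u by rewrite -(ler_pM2r lam0_gt0) mul1r -lamP -vE.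
have detP : `|\det P| = 1.
  apply: (@mulIf _ `|D|); first by rewrite normr_eq0.
  by rewrite mul1r -normrM -krylov_formM// -vE.
have [k [m [/andP[k0 kK] Pk]]] := HK P u PC lamP u1 detP.
have /dvdnP[h hE] : (k %| K`!)%N by rewrite dvdn_fact// k0.
have PK : P ^+ K`! = C ^+ (m * h) by rewrite hE mulnC exprM Pk -exprM.
have cong : eqmx_mod M (C ^+ (m * h)) (C ^+ (i * K`!)).
  by rewrite -PK exprM; exact: eqmx_modX.
have /dvdnP[s mhE] : (K`! %| m * h)%N.
  case: (leqP (m * h) (i * K`!)) => [le|/ltnW le].
    have dv := HM _ (eqmx_modX_inj C_unit le cong).
    by rewrite -(dvdn_addr _ dv) subnK ?dvdn_mull.
  have dv := HM _ (eqmx_modX_inj C_unit le (eqmx_mod_sym cong)).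
  by rewrite -(subnK le) dvdn_add// dvdn_mull.
exists s.
have us : u = beta ^+ s.
  have u0 : 0 <= u by rewrite (le_trans _ u1).
  apply/eqP; rewrite -(@eqrXn2 _ K`!) ?fact_gt0 ?exprn_ge0 ?(ltW beta_gt0)//.
  rewrite -exprM -mhE; apply/eqP/(mulIf (lt0r_neq0 lam0_gt0)).
  rewrite -eigenform_pow -PK; elim: (K`!) => [|n IHn]; first by rewrite mul1mx mul1r.
  by rewrite !exprS -mulmxE -mulmxA lamP -IHn mulrA.
apply/eqP; rewrite -subr_eq0; apply/eqP/eigenform_inj.
rewrite -scaleN1r eigenformD eigenformZ eigenform_pow vE lamP us.
by rewrite mulN1r subrr.
Qed.

Local Notation vec := (nearest_pows d beta).

(** The head [n] and the nearest multiples of [beta ^ j] determine [lam] up to a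
    bounded error. *)
Hypothesis ell_pows : \sum_j ell j * beta ^+ j = lam v0.

(** The norm test, completed in degree two by a sign that tells a unit from its
    opposite. *)
Hypothesis G_gen_poly : gen_poly_pred R G.
Hypothesis G_sound : forall n, G n ->
  `|krylov_form C (vec n)| = `|D| /\ 0 < lam (vec n).
Hypothesis G_complete : forall n i, vec n = C ^+ i *m v0 -> G n.

Local Notation t i := ((C ^+ i *m v0) 0 0).

Lemma orbit_head_close e : 0 < e -> exists i0, forall i, (i0 <= i)%N ->
  `|(t i)%:~R - beta ^+ i| < e.
Proof.
move=> e0; have le0 : 0 < (lam v0 * e) ^+ 2 by rewrite exprn_gt0 ?mulr_gt0.
have [i0 Hi0] := expr_eventually_small (c * rho v0) r01 le0.
exists i0 => i /Hi0 small; have := rho_bound (C ^+ i *m v0).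
rewrite eigenform_pow rho_pow.
have -> : c * (r ^+ i * rho v0) = c * rho v0 * r ^+ i by ring.
have -> : lam v0 * (t i)%:~R - beta ^+ i * lam v0 =
  lam v0 * ((t i)%:~R - beta ^+ i) by rewrite mulrBr [beta ^+ i * _]mulrC.
move=> /le_lt_trans h; have := h _ small.
rewrite -real_normK ?num_real// ltr_pXn2r// ?nnegrE//; last first.
  by rewrite mulr_ge0// ltW.
by rewrite normrM (gtr0_norm lam0_gt0) ltr_pM2l.
Qed.

(** The entries of [C ^ i v0] are [t i, t (i + 1), ..], and both [t (i + j)] and
    [beta ^ j * t i] are close to [beta ^ (i + j)]. *)
Lemma nearest_orbit : exists i0, forall i, (i0 <= i)%N ->
  nearest_int (beta ^+ i) = t i /\ vec (t i) = C ^+ i *m v0.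
Proof.
have b0 : 0 < beta by exact: lt_trans beta_gt1.
have bd0 : 0 < beta ^+ d by rewrite exprn_gt0.
have bd1 : 1 <= beta ^+ d by rewrite exprn_ege1// ltW.
(* The error of [t i] is multiplied by at most [beta ^+ d], and the two errors
   together have to stay below 1/2. *)
pose e := (8 * beta ^+ d)^-1.
have e0 : 0 < e by rewrite invr_gt0 mulr_gt0.
have ebd : e * beta ^+ d = 8^-1 by rewrite /e invfM mulfVK// gt_eqF.
have e8 : e <= 8^-1 by rewrite -ebd ler_peMr// ltW.
have [i0 Hi0] := orbit_head_close e0; exists i0 => i le_i; split.
  by apply: nearest_intE; apply: lt_le_trans (Hi0 i le_i) _; lra.
apply/matrixP => j k; rewrite ord1 [RHS]C_shift_pow mulmxA mulmxE -exprD [LHS]mxE.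
apply: nearest_intE; set x := (t i)%:~R; set y := (t (j + i))%:~R.
have -> : y - x * beta ^+ j =
    (y - beta ^+ (j + i)) - beta ^+ j * (x - beta ^+ i) by rewrite exprD; ring.
apply: le_lt_trans (ler_normB _ _) _; rewrite normrM (gtr0_norm (exprn_gt0 j b0)).
have h1 : `|y - beta ^+ (j + i)| < e by apply: Hi0; rewrite (leq_trans le_i)// leq_addl.
have h2 : beta ^+ j * `|x - beta ^+ i| <= 8^-1.
  rewrite -ebd [e * _]mulrC; apply: ler_pM => //; first by rewrite exprn_ge0// ltW.
    by rewrite ler_eXn2l// -ltnS.
  exact/ltW/Hi0.
lra.
Qed.

Lemma eigenform_nearest_pows n :
  `|lam (vec n) - lam v0 * n%:~R| <= \sum_j `|ell j|.
Proof.
rewrite -ell_pows mulr_suml -sumrB; apply: le_trans (ler_norm_sum _ _ _) _.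
apply: ler_sum => j _; rewrite mxE -mulrA [beta ^+ j * _]mulrC -mulrBr normrM.
by rewrite ler_piMr//; apply: le_trans (nearest_int_dist _) _; lra.
Qed.

Lemma nearest_pows_head n : vec n 0 0 = n.
Proof. by rewrite mxE mulr1; apply: nearest_intE; rewrite subrr normr0 invr_gt0. Qed.

(** The condition [G n && F n] characterises the set for all [n] of large absolute
    value: largeness of [n] makes [lam (vec n)] at least [lam v0], as
    [orbit_filter] requires, and excludes the small exponents [i] for which the
    integer nearest to [beta ^ i] is not [t i]. *)
Theorem nearest_powers_gen_poly :
  gen_poly_set R [set nearest_int (beta ^+ i) | i in [set: nat]].
Proof.
have [i0 Hi0] := nearest_orbit.
have [M M0 HM] := orbit_filter.
have [o [o0 oC _]] := order_mod_exists C_unit M0.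
pose F n := has (fun i => eqmx_mod M (vec n) (C ^+ i *m v0)) (iota 0 o).
have gF : gen_poly_pred R F.
  apply: gen_poly_pred_has => i; rewrite /eqmx_mod.
  apply: gen_poly_pred_forall => j; apply: gen_poly_pred_forall => k.
  apply: gen_poly_pred_dvd => //.
  apply: eq_gen_poly (gen_poly_add (gen_poly_nearest (gen_poly_mul
    (gen_poly_id R) (gen_poly_cst (beta ^+ j))))
    (gen_poly_cst (- ((C ^+ i *m v0) j k)%:~R))) => n /=.
  by rewrite rmorphB /= [vec n j k]mxE.
pose L : R := \sum_j `|ell j|.
pose n1 := (Num.truncn ((lam v0 + L) / lam v0)).+1.
have n1P (x : R) : n1%:R <= x -> lam v0 + L <= lam v0 * x.
  move=> n1x; rewrite mulrC -ler_pdivrMr//; apply: le_trans n1x.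
  exact/ltW/truncnS_gt.
(* [n1] makes [lam] large, the sum excludes the exponents below [i0]. *)
pose n0 := (n1 + (\sum_(i < i0) (`|t i| + `|nearest_int (beta ^+ i)|)).+1)%N.
have n0t i (n : int) : (n0 <= `|n|)%N -> n = t i \/ n = nearest_int (beta ^+ i) ->
    (i0 <= i)%N.
  move=> n0n tn; rewrite leqNgt; apply/negP => lt_i.
  move: n0n; rewrite /n0 (bigD1 (Ordinal lt_i))//=.
  case: tn => ->; move: (\sum_(_ < _ | _) _)%N (absz (t i)).
    by move: (absz (nearest_int _)) => x y z; lia.
  by move: (absz (nearest_int _)) => x y z; lia.
apply: (@gen_poly_set_almost R _ (fun n => G n && F n) n0).
  exact: gen_poly_predI.
move=> n n0n; split.
  move=> [i _ nE]; have le_i : (i0 <= i)%N by apply: (n0t i n) => //; right.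
  have [bi vi] := Hi0 i le_i.
  have vn : vec n = C ^+ i *m v0 by rewrite -nE bi.
  rewrite (G_complete vn) /=; apply/hasP; exists (i %% o)%N.
    by rewrite mem_iota ltn_mod.
  rewrite vn; apply: eqmx_mod_mul (eqmx_mod_refl _ _).
  rewrite {1}(divn_eq i o) exprD mulnC exprM -[X in eqmx_mod _ _ X]mul1r.
  apply: eqmx_mod_mul (eqmx_mod_refl _ _).
  by rewrite -(expr1n _ (i %/ o)); exact: eqmx_modX.
move=> /andP[/G_sound[Nn ln] /hasP[i _ /HM]] H.
have := eigenform_nearest_pows n; rewrite -/L => /ler_normlP[h1 h2].
have big : lam v0 + L <= lam v0 * `|n%:~R|.
  apply: n1P; rewrite -intr_norm -natr_absz ler_nat.
  by rewrite (leq_trans _ n0n)// leq_addr.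
have n_gt0 : 0 < n.
  rewrite -(ltr0z R) ltNge; apply/negP => n_le0.
  move: big; rewrite ler0_norm// mulrN; move: h1 h2 ln lam0_gt0.
  by move: (lam v0 * n%:~R) (lam v0) (lam _) (L) => ? ? ? ?; lra.
have [|j vE] := H Nn.
  move: big; rewrite gtr0_norm ?ltr0z//; move: h1 h2 ln lam0_gt0.
  by move: (lam v0 * n%:~R) (lam v0) (lam _) (L) => ? ? ? ?; lra.
have nE : n = t j by rewrite -vE nearest_pows_head.
exists j => //; have [] // := Hi0 j.
  by apply: (n0t j n) => //; left.
by move=> ->; rewrite nE.
Qed.

End PisotLattice.

(** * Companion matrices of degrees two and three *)

Definition companion d (q : 'I_d.+1 -> int) : 'M[int]_d.+1 :=
  \matrix_(i, j) if i == ord_max then q j else (j == i.+1 :> nat)%:R.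

Lemma companion_shift d (q : 'I_d.+1 -> int) (v : 'cV[int]_d.+1) (j k : 'I_d.+1) :
  k = j.+1 :> nat -> (companion q *m v) j 0 = v k 0.
Proof.
move=> kj; have jd : j != ord_max.
  by apply: contraTneq (ltn_ord k) => jE; rewrite kj jE /= ltnn.
rewrite mxE (bigD1 k)//= big1 ?addr0 => [|i ik]; rewrite !mxE (negPf jd).
  by rewrite kj eqxx mul1r.
by rewrite -kj -[_ == _ :> nat]/(i == k) (negPf ik) mul0r.
Qed.

Lemma companion_last d (q : 'I_d.+1 -> int) (v : 'cV[int]_d.+1) :
  (companion q *m v) ord_max 0 = \sum_j q j * v j 0.
Proof. by rewrite mxE; apply: eq_bigr => j _; rewrite mxE eqxx. Qed.

Lemma det_mx2 (K : comNzRingType) (A : 'M[K]_2) :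
  \det A = A 0 0 * A 1 1 - A 0 1 * A 1 0.
Proof.
rewrite (expand_det_row _ 0) !big_ord_recl big_ord0 /cofactor !det_mx11 !mxE.
have -> : lift 0 0 = 1 :> 'I_2 by apply/val_inj.
have -> : lift 1 0 = 0 :> 'I_2 by apply/val_inj.
by rewrite /=; ring.
Qed.

Lemma det_mx3 (K : comNzRingType) (A : 'M[K]_3) :
  \det A = A 0 0 * (A 1 1 * A 2 2 - A 1 2 * A 2 1)
         - A 0 1 * (A 1 0 * A 2 2 - A 1 2 * A 2 0)
         + A 0 2 * (A 1 0 * A 2 1 - A 1 1 * A 2 0).
Proof.
rewrite (expand_det_row _ 0) !big_ord_recl big_ord0 /cofactor !det_mx2 !mxE.
have -> : lift 0 (lift 0 0) = 2 :> 'I_3 by apply/val_inj.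
have -> : lift 0 0 = 1 :> 'I_3 by apply/val_inj.
have -> : lift 0 1 = 2 :> 'I_3 by apply/val_inj.
have -> : lift 1 0 = 0 :> 'I_3 by apply/val_inj.
have -> : lift 1 1 = 2 :> 'I_3 by apply/val_inj.
have -> : lift 2 0 = 0 :> 'I_3 by apply/val_inj.
have -> : lift 2 1 = 1 :> 'I_3 by apply/val_inj.
by rewrite /=; ring.
Qed.

Lemma sum_ord2 (V : nmodType) (F : 'I_2 -> V) : \sum_i F i = F 0 + F 1.
Proof.
rewrite !big_ord_recl big_ord0 addr0; congr (_ + F _).
exact/val_inj.
Qed.

Lemma sum_ord3 (V : nmodType) (F : 'I_3 -> V) : \sum_i F i = F 0 + F 1 + F 2.
Proof.
rewrite !big_ord_recl big_ord0 addr0 addrA; congr (_ + F _ + F _);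
exact/val_inj.
Qed.

Definition companion2 (a c : int) : 'M[int]_2 :=
  companion (fun j : 'I_2 => if j == 0 then c else a).

Lemma companion2E a c (v : 'cV[int]_2) :
  ((companion2 a c *m v) 0 0 = v 1 0) *
  ((companion2 a c *m v) 1 0 = c * v 0 0 + a * v 1 0).
Proof.
split; first exact: companion_shift.
have -> : 1 = ord_max :> 'I_2 by exact/val_inj.
by rewrite companion_last sum_ord2; congr (_ + _ * v _ _); exact/val_inj.
Qed.

Lemma krylov_form2 a c (v : 'cV[int]_2) :
  krylov_form (companion2 a c) v =
  v 0 0 * (c * v 0 0 + a * v 1 0) - v 1 0 ^+ 2.
Proof.
rewrite /krylov_form det_mx2 !krylovE expr0 expr1 mul1mx.
by rewrite !companion2E expr2.
Qed.

Definition companion3 (a b : int) : 'M[int]_3 :=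
  companion (fun j : 'I_3 => if j == 0 then 1 else if j == 1 then b else a).

Lemma companion3E a b (v : 'cV[int]_3) :
  ((companion3 a b *m v) 0 0 = v 1 0) *
  ((companion3 a b *m v) 1 0 = v 2 0) *
  ((companion3 a b *m v) 2 0 = v 0 0 + b * v 1 0 + a * v 2 0).
Proof.
split; first by split; exact: companion_shift.
have -> : 2 = ord_max :> 'I_3 by exact/val_inj.
rewrite companion_last sum_ord3 /= mul1r; congr (_ + _ + _ * v _ _).
exact/val_inj.
Qed.

Lemma krylov_form3 a b (v : 'cV[int]_3) :
  let x3 := v 0 0 + b * v 1 0 + a * v 2 0 in
  let x4 := v 1 0 + b * v 2 0 + a * x3 in
  krylov_form (companion3 a b) v =
    v 0 0 * (v 2 0 * x4 - x3 ^+ 2)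
  - v 1 0 * (v 1 0 * x4 - x3 * v 2 0)
  + v 2 0 * (v 1 0 * x3 - v 2 0 ^+ 2).
Proof.
move=> x3 x4; rewrite /krylov_form det_mx3 !krylovE expr0 expr1.
have -> : companion3 a b ^+ (2%R : 'I_3) *m v = companion3 a b *m (companion3 a b *m v).
  by rewrite mulmxA.
rewrite mul1mx !companion3E -/x3 -/x4.
by ring.
Qed.

Lemma det_companion2 a c : \det (companion2 a c) = - c.
Proof. by rewrite det_mx2 !mxE /=; ring. Qed.

Lemma det_companion3 a b : \det (companion3 a b) = 1.
Proof. by rewrite det_mx3 !mxE /=; ring. Qed.

(** * Quadratic units *)

(** With [b' = a - beta] the other root, the norm form factors as
    [- (m - beta n) * (m - b' n)] on a vector [(n, m)].  The first factor [dev n]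
    has absolute value at most 1/2 on [nearest_pows], so its sign is its integer
    part.  Together with the sign of the norm form it decides the sign of
    [lam], which the norm form alone cannot do: in even degree [v] and [- v] have
    the same norm. *)
Lemma quadratic_powers (R : realType) (beta : R) (a c : int) :
  1 < beta -> `|c| = 1 -> beta ^+ 2 = a%:~R * beta + c%:~R ->
  gen_poly_set R [set nearest_int (beta ^+ i) | i in [set: nat]].
Proof.
move=> b1 c1 betaE.
have sqz (x : int) : `|x| ^+ 2 = x ^+ 2 := real_normK (num_real x).
have c2 : c%:~R ^+ 2 = 1 :> R.
  by rewrite -(rmorphXn intr) -sqz c1.
have b0 : 0 < beta by exact: lt_trans b1.
pose b' : R := a%:~R - beta.
have aE : a%:~R = beta + b' by rewrite /b'; ring.
have cE : c%:~R = - (beta * b') :> R by rewrite /b'; move: betaE; rewrite expr2 => e; lra.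
have bb' : (beta * b') ^+ 2 = 1 by rewrite -c2 cE sqrrN.
have r01 : 0 < b' ^+ 2 < 1.
  have b'0 : b' != 0.
    by apply: contra_eq_neq bb' => ->; rewrite mulr0 expr0n eq_sym oner_eq0.
  have b'2 : 0 < b' ^+ 2 by rewrite exprn_even_gt0.
  rewrite b'2 -bb' exprMn -subr_gt0.
  by rewrite -[X in _ - X]mul1r -mulrBl mulr_gt0// subr_gt0 exprn_egt1.
have b'b : b' < beta.
  by case/andP: r01 => _ h; nra.
pose C := companion2 a c.
pose v0 : 'cV[int]_2 := \col_i (if i == 0 then 2 else a).
pose ell (i : 'I_2) : R := if i == 0 then - b' else 1.
pose rho (v : 'cV[int]_2) : R := ((v 1 0)%:~R - beta * (v 0 0)%:~R) ^+ 2.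
have lamE v : eigenform ell v = (v 1 0)%:~R - b' * (v 0 0)%:~R.
  by rewrite /eigenform sum_ord2 /ell /=; ring.
have formE v : (krylov_form C v)%:~R = - (((v 1 0)%:~R - beta * (v 0 0)%:~R) *
    eigenform ell v) :> R.
  rewrite krylov_form2 lamE !(rmorphB, rmorphD, rmorphM, rmorphXn) /= aE cE.
  by ring.
have lam0E : eigenform ell v0 = beta - b' by rewrite lamE !mxE /= aE; ring.
have lam0 : 0 < eigenform ell v0 by rewrite lam0E subr_gt0.
have DE : (krylov_form C v0)%:~R = (beta - b') ^+ 2 :> R.
  by rewrite formE lam0E !mxE /= aE; ring.
have D0 : 0 < krylov_form C v0 by rewrite -(ltr0z R) DE exprn_gt0 ?subr_gt0.
have detC i : `|\det C ^+ i| = 1 by rewrite det_companion2 normrX normrN c1 expr1n.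
pose dev n : R := (nearest_pows 1 beta n 1 0)%:~R - beta * n%:~R.
pose G n := ((krylov_form C (nearest_pows 1 beta n) == krylov_form C v0)
    && (Num.floor (dev n) == -1))
  || ((krylov_form C (nearest_pows 1 beta n) == - krylov_form C v0)
    && (Num.floor (dev n) == 0)).
have devE n : (krylov_form C (nearest_pows 1 beta n))%:~R =
    - (dev n * eigenform ell (nearest_pows 1 beta n)).
  by rewrite formE (nearest_pows_head 1 beta).
have D0R : 0 < (krylov_form C v0)%:~R :> R by rewrite ltr0z.
apply: (@nearest_powers_gen_poly R 1 C v0 G beta (b' ^+ 2) 1 ell rho) => //.
- by rewrite unitmxE det_companion2; move: c1; case: (c) => [[|[|n]]|[|n]].
- by move=> v j k; exact: companion_shift.
- by move=> v; rewrite !lamE !companion2E rmorphD !rmorphM /= aE cE; ring.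
- by move=> v; rewrite /rho !companion2E rmorphD !rmorphM /= aE cE; ring.
- by move=> v; rewrite lam0E lamE /rho mul1r le_eqVlt; apply/orP; left; apply/eqP; ring.
- by rewrite gt_eqF.
- exists ((krylov_form C v0)%:~R ^+ 2 / (beta - b') ^+ 2) => v Nv lv.
  have l2 : (beta - b') ^+ 2 <= eigenform ell v ^+ 2.
    by rewrite -lam0E ler_pXn2r ?nnegrE// ltW// (lt_le_trans lam0).
  rewrite ler_pdivlMr ?exprn_gt0 ?subr_gt0//.
  have -> : (krylov_form C v0)%:~R ^+ 2 = rho v * eigenform ell v ^+ 2 :> R.
    rewrite -(rmorphXn intr) -sqz -Nv sqz rmorphXn /= formE.
    by rewrite sqrrN exprMn.
  by rewrite ler_wpM2l// sqr_ge0.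
- by rewrite lam0E sum_ord2 /ell /= expr0 expr1; ring.
- have gN := gen_poly_krylov_form C beta.
  have gdev : gen_poly (fun n => (Num.floor (dev n))%:~R : R).
    apply/gen_poly_floor/gen_poly_add.
      apply: eq_gen_poly (gen_poly_nearest (gen_poly_mul (gen_poly_id R)
        (gen_poly_cst (beta ^+ (1%R : 'I_2))))) => n.
      by rewrite [nearest_pows _ _ _ _ _]mxE.
    exact/gen_polyN/gen_poly_mul/gen_poly_id/gen_poly_cst.
  by apply: gen_poly_predU; apply: gen_poly_predI; apply: gen_poly_pred_eq.
- move=> n /orP[]/andP[/eqP Nn /eqP fl].
    split; first by rewrite Nn.
    have dev0 : dev n < 0 by rewrite -floor_lt0 fl.
    by have := devE n; rewrite Nn => e; nra.
  split; first by rewrite Nn normrN.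
  have dev0 : 0 <= dev n by rewrite -floor_ge0 fl.
  by have := devE n; rewrite Nn rmorphN => e; nra.
- move=> n i vn.
  have ln : 0 < eigenform ell (nearest_pows 1 beta n).
    rewrite vn lamE -lamE (_ : eigenform ell _ = beta ^+ i * eigenform ell v0).
      by rewrite mulr_gt0// exprn_gt0.
    apply: eigenform_pow => v.
    by rewrite !lamE !companion2E rmorphD !rmorphM /= aE cE; ring.
  have dev2 : `|dev n| <= 2^-1.
    by rewrite /dev mxE mulrC; exact: nearest_int_dist.
  have := devE n; rewrite /G vn krylov_form_pow; move: (detC i).
  have [->|->] : \det C ^+ i = 1 \/ \det C ^+ i = -1 by move: (detC i); lia.
    rewrite mul1r eqxx /= -vn => _ e; apply/orP; left; apply/eqP/floor_def.
    by move/ler_normlP: dev2 => [h1 h2]; apply/andP; split; nra.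
  rewrite mulN1r eqxx /= rmorphN -vn => _ e; apply/orP; right; apply/eqP/floor_def.
  by move/ler_normlP: dev2 => [h1 h2]; apply/andP; split; nra.
Qed.

(** * Cubic units with complex conjugates *)

(** If the cofactor [x ^ 2 - s x + t] of [x - beta] had a real root, both of its
    roots would be [beta], and their product [t = 1 / beta] would be
    [beta ^ 2]. *)
Lemma cubic_cofactor_discr (R : realType) (beta s t : R) : 1 < beta ->
  t * beta = 1 -> (forall x, x ^+ 2 - s * x + t = 0 -> x = beta) ->
  s ^+ 2 < 4 * t.
Proof.
move=> b1 tb root; rewrite ltNge; apply/negP => disc.
pose y := Num.sqrt (s ^+ 2 - 4 * t).
have yE : y ^+ 2 = s ^+ 2 - 4 * t by rewrite sqr_sqrtr// subr_ge0.
have h1 : (s + y) / 2 = beta by apply: root; field: yE.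
have h2 : (s - y) / 2 = beta by apply: root; field: yE.
have y0 : y = 0 by lra.
have sE : s = 2 * beta by lra.
have tE : t = beta ^+ 2 by move: yE; rewrite y0 sE; nra.
have : 1 < beta ^+ 3 by rewrite exprn_egt1.
by rewrite exprSr -tE tb ltxx.
Qed.

(** Let [x ^ 2 - s x + t] be the cofactor of [x - beta].  The components [e1] and
    [e2] of a vector vanish on the expanding direction and [C] acts on them
    through the cofactor; [rho] is the form that it scales by [t], and it is
    definite because the cofactor has no real root.  The norm form is
    [- lam * rho], so its sign already fixes the sign of [lam]. *)
Lemma cubic_powers (R : realType) (beta : R) (a b : int) :
  1 < beta -> beta ^+ 3 = a%:~R * beta ^+ 2 + b%:~R * beta + 1 ->
  (forall x : R, x ^+ 3 = a%:~R * x ^+ 2 + b%:~R * x + 1 -> x = beta) ->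
  gen_poly_set R [set nearest_int (beta ^+ i) | i in [set: nat]].
Proof.
move=> b1 betaE root.
have b0 : 0 < beta by exact: lt_trans b1.
pose s : R := a%:~R - beta; pose t : R := beta^-1.
have tb : t * beta = 1 by rewrite mulVf// gt_eqF.
have t0 : 0 < t by rewrite invr_gt0.
have t1 : t < 1 by rewrite invf_lt1.
have aE : a%:~R = s + beta by rewrite /s; ring.
have bE : b%:~R = - (s * beta + t) :> R.
  apply: (mulIf (lt0r_neq0 b0)).
  by move: betaE; rewrite aE => e; nra.
have disc : s ^+ 2 < 4 * t.
  apply: (cubic_cofactor_discr b1 tb) => x xE; apply: root.
  have : (x - beta) * (x ^+ 2 - s * x + t) = 0 by rewrite xE mulr0.
  move=> e; apply/eqP; rewrite -subr_eq0 -[X in _ == X]e aE bE.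
  by apply/eqP; ring: tb.
pose g := beta ^+ 2 - s * beta + t.
have g0 : 0 < g by have := sqr_ge0 (beta - s / 2); rewrite /g; nra.
pose C := companion3 a b.
pose v0 : 'cV[int]_3 :=
  \col_i (if i == 0 then 3 else if i == 1 then a else a ^+ 2 + 2 * b).
pose ell (i : 'I_3) : R := if i == 0 then t else if i == 1 then - s else 1.
pose e1 (v : 'cV[int]_3) : R := (v 1 0)%:~R - beta * (v 0 0)%:~R.
pose e2 (v : 'cV[int]_3) : R := (v 2 0)%:~R - beta * (v 1 0)%:~R.
pose rho v : R := e2 v ^+ 2 - s * e1 v * e2 v + t * e1 v ^+ 2.
have lamE v : eigenform ell v = (v 2 0)%:~R - s * (v 1 0)%:~R + t * (v 0 0)%:~R.
  by rewrite /eigenform sum_ord3 /ell /=; ring.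
have rhoE v : rho v =
    (e2 v - s / 2 * e1 v) ^+ 2 + (4 * t - s ^+ 2) / 4 * e1 v ^+ 2.
  by rewrite /rho; field.
have rho_ge0 v : 0 <= rho v.
  rewrite rhoE addr_ge0 ?sqr_ge0// mulr_ge0 ?sqr_ge0// divr_ge0// subr_ge0.
  exact: ltW.
have e1C v : e1 (C *m v) = e2 v by rewrite /e1 !companion3E.
have e2C v : e2 (C *m v) = s * e2 v - t * e1 v.
  rewrite /e1 /e2 !companion3E !(rmorphD, rmorphM) /= aE bE.
  by ring: tb.
have lamC v : eigenform ell (C *m v) = beta * eigenform ell v.
  rewrite !lamE !companion3E !(rmorphD, rmorphM) /= aE bE.
  by ring: tb.
have formE v : (krylov_form C v)%:~R = - (eigenform ell v * rho v) :> R.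
  rewrite krylov_form3 lamE /rho /e1 /e2.
  rewrite !(rmorphB, rmorphD, rmorphM, rmorphXn) /= aE bE.
  by ring: tb.
have lam0E : eigenform ell v0 = g.
  rewrite lamE !mxE /= !(rmorphD, rmorphM, rmorphXn) /= aE bE /g.
  by ring: tb.
have lam0 : 0 < eigenform ell v0 by rewrite lam0E.
have rho0 : 0 < rho v0.
  have e10 : e1 v0 != 0.
    rewrite /e1 !mxE /= aE; apply/eqP => h.
    have sE : s = 2 * beta by lra.
    have : 1 < beta ^+ 3 by rewrite exprn_egt1.
    move: disc; rewrite sE exprS; nra.
  rewrite rhoE ltr_wpDl ?sqr_ge0// mulr_gt0// ?divr_gt0 ?subr_gt0//.
  by rewrite exprn_even_gt0.
have D0R : (krylov_form C v0)%:~R < 0 :> R.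
  by rewrite formE oppr_lt0 mulr_gt0.
have detC i : \det C ^+ i = 1 by rewrite det_companion3 expr1n.
(* Completing the square as in [rhoE] bounds the square of a linear form in [e1]
   and [e2] by [k * rho]. *)
pose k := 2 + 8 * (beta - s / 2) ^+ 2 / (4 * t - s ^+ 2).
have k0 : 0 <= 8 * (beta - s / 2) ^+ 2 / (4 * t - s ^+ 2).
  by rewrite divr_ge0 ?subr_ge0 ?(ltW disc)// mulr_ge0// sqr_ge0.
apply: (@nearest_powers_gen_poly R 2 C v0
  (fun n => krylov_form C (nearest_pows 2 beta n) == krylov_form C v0)
  beta t k ell rho) => //.
- by rewrite unitmxE det_companion3 unitr1.
- by move=> v i j; exact: companion_shift.
- by rewrite t0 t1.
- by rewrite addr_ge0.
- by move=> v; rewrite /rho e1C e2C; ring.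
- move=> v; rewrite lam0E.
  pose x := e2 v - s / 2 * e1 v; pose y := (beta - s / 2) * e1 v.
  pose p := 8 * (beta - s / 2) ^+ 2 / (4 * t - s ^+ 2) * x ^+ 2.
  pose q := (4 * t - s ^+ 2) / 2 * e1 v ^+ 2.
  have -> : g * (v 0 0)%:~R - eigenform ell v = - (x + y).
    by rewrite lamE /g /x /y /e1 /e2; field.
  have -> : k * rho v = 2 * x ^+ 2 + 2 * y ^+ 2 + p + q.
    by rewrite rhoE /k /p /q /y -/x; field; rewrite gt_eqF// subr_gt0.
  have p0 : 0 <= p by rewrite mulr_ge0// sqr_ge0.
  have q0 : 0 <= q by rewrite mulr_ge0 ?sqr_ge0// divr_ge0// subr_ge0 ltW.
  by have := sqr_ge0 (x - y); nra.
- by rewrite -(intr_eq0 R) lt_eqF.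
- exists (- (krylov_form C v0)%:~R / g) => v Nv lv.
  have lv0 : 0 <= eigenform ell v by rewrite (le_trans _ lv)// ltW.
  have NvR : eigenform ell v * rho v = - (krylov_form C v0)%:~R.
    rewrite -(ltr0_norm D0R) -intr_norm -Nv intr_norm formE normrN ger0_norm//.
    exact: mulr_ge0.
  by rewrite ler_pdivlMr// -NvR mulrC ler_wpM2r// -lam0E.
- by rewrite lam0E sum_ord3 /ell /= expr0 expr1 /g; ring.
- exact: gen_poly_pred_eq (gen_poly_krylov_form C beta).
- move=> n /eqP Nn; split; first by rewrite Nn.
  have := formE (nearest_pows 2 beta n); rewrite Nn => e.
  by have := rho_ge0 (nearest_pows 2 beta n); nra.
- by move=> n i ->; rewrite krylov_form_pow detC mul1r.
Qed.

Theorem theoremB (R : realType) (beta : R) :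
  1 < beta ->
  (exists a : int,
      beta ^+ 2 = a%:~R * beta + 1 \/ beta ^+ 2 = a%:~R * beta - 1)
  \/
  (exists a b : int,
      ((0 <= a /\ 0 <= b <= a + 1) \/ (2 <= a /\ b = -1)) /\
      beta ^+ 3 = a%:~R * beta ^+ 2 + b%:~R * beta + 1 /\
      (forall x : R, x ^+ 3 = a%:~R * x ^+ 2 + b%:~R * x + 1 -> x = beta)) ->
  gen_poly_set R [set nearest_int (beta ^+ i) | i in [set: nat]].
Proof.
move=> b1 [[a [betaE|betaE]]|[a [b [_ [betaE root]]]]].
- exact: (@quadratic_powers _ _ a 1).
- by apply: (@quadratic_powers _ _ a (-1)).
- exact: cubic_powers betaE root.
Qed.
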